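(* Let $n\in\mathbb N$ and let $c$ be a nonzero real number. Let $f$ be a well defined $n$-th tropical meromorphic function on $\mathbb R$ with hyper-order $$\rho_2(f)=:\rho_2<1,$$ and let $\sigma\in(0,1-\rho_2)$. Then, for $\delta=\pm1$, $$\left|f(\delta r+c)\oslash f(\delta r)\right|=o\left(\frac{T(r,f)}{r^{\sigma}}\right)$$ as $r$ tends to infinity outside of a set of finite logarithmic measure.
   Context: $\mathbb N=\{1,2,\dots\}$. For $n\in\mathbb N$, an $n$-th tropical meromorphic function is a continuous function $f:\mathbb R\to\mathbb R$ for which there is an increasing sequence of breakpoints $\{x_i\}$ without finite accumulation point such that on each $[x_{i-1},x_i]$ $f$ equals a polynomial of degree $n_i$, with $\sup_i n_i=n$ (in particular $f$ is non-constant). A polynomial $p$ of degree $k\ge1$ is called well defined if $p(x)-p(0)=\sum_{j=1}^m a_{2j-1}x^{2j-1}$ when $k=2m-1$, and $p(x)-p(0)=\sum_{j=1}^m a_{2j}x^{2j}$ when $k=2m$, where the coefficients are either all non-negative or all non-positive; constants also count as well defined. An $n$-th tropical meromorphic function is well defined if it is a well defined polynomial on each of its segments. $a\oslash b$ means $a-b$. Sign convention: $\operatorname{sgn}(x^{\pm})=\operatorname{sgn}(x)$ for $x\ne0$ and $\operatorname{sgn}(0^{\pm})=\pm1$. For $1\le j\le n$, $\omega_f^{(j)}(x)=\frac{1}{j!}\left(\operatorname{sgn}^{j+1}(x^+)f^{(j)}(x^+)-\operatorname{sgn}^{j+1}(x^-)f^{(j)}(x^-)\right)$, with one-sided derivatives.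 A point $x$ is a $j$-th pole if $\omega_f^{(j)}(x)<0$. $m(r,f)=\frac12(f^+(r)+f^+(-r))$ with $f^+=\max\{f,0\}$; $N^{(j)}(r,f)=\frac12\sum_z|\omega_f^{(j)}(z)|(r-|z|)^j$, the sum running over all $j$-th poles $z$ of $f$ in $(-r,r)$; $T(r,f)=m(r,f)+\sum_{j=1}^nN^{(j)}(r,f)$. The hyper-order is $\rho_2(f)=\limsup_{r\to\infty}\frac{\log\log T(r,f)}{\log r}$. A set $E\subset(0,\infty)$ has finite logarithmic measure if $\int_{E\cap[1,\infty)}dr/r<\infty$. *)

(* Defs.v *)
From HB Require Import structures.
From mathcomp Require Import all_boot all_order all_algebra.
From mathcomp Require Import all_classical all_reals all_analysis.

Set Implicit Arguments.
Unset Strict Implicit.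
Unset Printing Implicit Defensive.

Import Order.TTheory GRing.Theory Num.Theory.
Import numFieldNormedType.Exports.

Local Open Scope classical_set_scope.
Local Open Scope ring_scope.

Section TropicalMeromorphic.
Context {R : realType}.
Implicit Types (f : R -> R) (p : {poly R}) (x r : R) (n j : nat).

(* The zero polynomial is given degree 0, like the other constants. *)
Definition degree p : nat := (size p).-1.

Definition same_sign_coefs (m : nat) (a : nat -> R) : Prop :=
  (forall j, (1 <= j <= m)%N -> 0 <= a j) \/
  (forall j, (1 <= j <= m)%N -> a j <= 0).

(* [a j] stands for the coefficient a_(2j-1), resp. a_(2j). *)
Definition well_defined_poly p : Prop :=
  degree p = 0%N \/
  exists (m : nat) (a : nat -> R),
    [/\ (0 < m)%N, same_sign_coefs m a &
     (degree p = (2 * m - 1)%N /\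
        p - (p.[0])%:P = \sum_(1 <= j < m.+1) a j *: 'X^(2 * j - 1)) \/
     (degree p = (2 * m)%N /\
        p - (p.[0])%:P = \sum_(1 <= j < m.+1) a j *: 'X^(2 * j))].

(* Breakpoints are indexed by [int]: with no finite accumulation point they
   tend to -oo and +oo, so the segments cover the line.  The function need not
   change its expression at a breakpoint, so functions with finitely many, or
   one-sidedly many, genuine breakpoints are covered too. *)
Definition breakpoints (b : int -> R) : Prop :=
  {homo b : i k / i < k} /\ limit_point (range b) = set0.

Definition piecewise_poly n f (b : int -> R) (P : int -> {poly R}) : Prop :=
  [/\ breakpoints b,
      forall i x, b (i - 1) <= x <= b i -> f x = (P i).[x] &
      supremums (range (degree \o P)) n].

Definition tropical_meromorphic n f : Prop :=
  continuous f /\ exists b P, piecewise_poly n f b P.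

(* The polynomials [P i] are determined by [f] and [b], and refining [b] does
   not change them, so the existential choice of [b] and [P] is harmless. *)
Definition well_defined_meromorphic n f : Prop :=
  tropical_meromorphic n f /\ exists b P,
    piecewise_poly n f b P /\ forall i, well_defined_poly (P i).

Definition deriv_right f x : R := lim ((f (x + h) - f x) / h @[h --> 0^'+]).
Definition deriv_left f x : R := lim ((f (x + h) - f x) / h @[h --> 0^'-]).

Definition sgn_right x : R := if x == 0 then 1 else Num.sg x.
Definition sgn_left x : R := if x == 0 then -1 else Num.sg x.

Definition omega j f x : R :=
  (j`!)%:R^-1 * (sgn_right x ^+ j.+1 * iter j deriv_right f x -
                 sgn_left x ^+ j.+1 * iter j deriv_left f x).

Definition pole j f x : Prop := omega j f x < 0.

Definition proximity r f : R :=
  2^-1 * (Num.max (f r) 0 + Num.max (f (- r)) 0).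

(* For an [n]-th tropical meromorphic [f] and [j >= 1], a [j]-th pole is a
   breakpoint or 0, so the sum ranges over a finite set. *)
Definition counting j r f : R :=
  2^-1 * \sum_(z \in [set z | pole j f z /\ - r < z < r])
            `|omega j f z| * (r - `|z|) ^+ j.

Definition characteristic n r f : R :=
  proximity r f + \sum_(1 <= j < n.+1) counting j r f.

Definition hyper_order n f : \bar R :=
  limf_esup (fun r => (ln (ln (characteristic n r f)) / ln r)%:E) +oo%R.

Definition finite_log_measure (E : set R) : Prop :=
  [/\ measurable E, E `<=` [set r | 0 < r] &
   (\int[lebesgue_measure]_(r in E `&` `[1%R, +oo[) (r^-1)%:E < +oo)%E].

End TropicalMeromorphic.

(* Main.v *)
Require Import Defs.
From HB Require Import structures.
From mathcomp Require Import all_boot all_order all_algebra.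
From mathcomp Require Import all_classical all_reals all_analysis.
From mathcomp Require Import measurable_realfun.
From mathcomp Require Import zify ring lra.

Import Order.TTheory GRing.Theory Num.Theory.
Import numFieldNormedType.Exports.

Local Open Scope classical_set_scope.
Local Open Scope ring_scope.

(** Along each half-line [f (delta * r) - f 0] is a sum of truncated powers
    [a_mj * (r - t_m)_+ ^ j], where [t_0 = 0] and, for [m > 0], [a_mj] is
    [omega j f] at the breakpoint [delta * t_m].  Let [U r] be the same sum with
    [`|a_mj|] in place of [a_mj]; then increments of [f] are bounded by
    increments of [U].  Adding the expansions of the two half-lines gives
    Jensen's formula, so poles and zeros of [f] are both counted by [T r f] up to
    [O(1)]; the terms at [t_0], invisible to [omega] when the two sides cancel,
    are recovered from [f] itself because a well defined polynomial has
    coefficients of one sign.  Hence [U r <= 12 * T r f + O(1)], while [U] is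
    either zero or at least linear.

    It remains to bound [U (r + h) - U (r - h)].  With [u_k = U (k * h)], call [k]
    bad if [u_(k+3) > (1 + (k+1) ^ (a - 1)) * u_k].  As [ln U r = O(r ^ tau)]
    with [tau < 1 - sigma], for suitable [q > 0] and [a < 1 - sigma] the bounded
    monotone sequence [- (ln u_k) ^ (- q)] gains at least a constant times
    [1 / (k+1)] from a bad [k] to [k+3].  So the sum of [1 / (k+1)] over bad [k]
    is finite, and the intervals indexed by bad [k] form the exceptional set. *)

(** * Jumps of piecewise polynomials *)

Section Local.
Context {R : realType}.
Implicit Types (f : R -> R) (p q : {poly R}) (x y z r : R).

Lemma horner_quotient_cvg p x :
  (p.[x + h] - p.[x]) / h @[h --> 0^'] --> p^`().[x].
Proof.
have [pd pv] := is_derive_poly p x.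
rewrite -pv; move: pd => /cvg_ex[l hl].
have -> : 'D_1 (horner p) x = l.
  by rewrite /derive; apply: (@cvg_lim R (@norm_hausdorff _ _)).
apply: cvg_trans hl; apply: near_eq_cvg; near=> h => /=.
by rewrite mulrC /GRing.scale/= [h * 1]mulr1 [x + h]addrC.
Unshelve. all: by end_near. Qed.

(** Right difference quotients only look to the right, so agreement on [[a, b[] survives each
    differentiation, including at the breakpoint [a] itself. *)
Lemma iter_deriv_right_poly f p a b j :
  {in `[a, b[, f =1 horner p} ->
  {in `[a, b[, iter j deriv_right f =1 horner p^`(j)}.
Proof.
move=> fp; elim: j => [|j IH] x; first exact: fp.
move=> xab /=; rewrite {1}/deriv_right (IH x xab).
apply: (@cvg_lim R (@norm_hausdorff _ _)).
have := @cvg_dnbhs_at_right _ _ _ _ _ (horner_quotient_cvg p^`(j) x).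
rewrite -derivnS; apply: cvg_trans; apply: near_eq_cvg.
near=> h; rewrite IH// in_itv/=.
have h0 : 0 < h by near: h; exact: nbhs_right_gt.
have hb : h < b - x.
  by near: h; apply: nbhs_right_lt; have := xab; rewrite in_itv/=; lra.
by have := xab; rewrite in_itv/=; lra.
Unshelve. all: by end_near. Qed.

Lemma iter_deriv_left_poly f p a b j :
  {in `]a, b], f =1 horner p} ->
  {in `]a, b], iter j deriv_left f =1 horner p^`(j)}.
Proof.
move=> fp; elim: j => [|j IH] x; first exact: fp.
move=> xab /=; rewrite {1}/deriv_left (IH x xab).
apply: (@cvg_lim R (@norm_hausdorff _ _)).
have := @cvg_dnbhs_at_left _ _ _ _ _ (horner_quotient_cvg p^`(j) x).
rewrite -derivnS; apply: cvg_trans; apply: near_eq_cvg.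
near=> h; rewrite IH// in_itv/=.
have h0 : h < 0 by near: h; exact: nbhs_left_lt.
have hb : a - x < h.
  by near: h; apply: nbhs_left_gt; have := xab; rewrite in_itv/=; lra.
by have := xab; rewrite in_itv/=; lra.
Unshelve. all: by end_near. Qed.

(** The factor [1 / j!] turns iterated derivatives into [nderivn], so [omega] compares the Taylor
    coefficients at [x] of the two adjacent polynomials. *)
Lemma omegaE f p q x j a b : a < x < b ->
  {in `]a, x], f =1 horner p} -> {in `[x, b[, f =1 horner q} ->
  omega j f x = sgn_right x ^+ j.+1 * q^`N(j).[x]
              - sgn_left x ^+ j.+1 * p^`N(j).[x].
Proof.
move=> /andP[ax xb] fp fq.
rewrite /omega (iter_deriv_right_poly _ _ _ _ j fq); last first.
  by rewrite in_itv/= lexx.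
rewrite (iter_deriv_left_poly _ _ _ _ j fp); last by rewrite in_itv/= lexx ax.
have fj : (j`!)%:R != 0 :> R by rewrite pnatr_eq0 -lt0n fact_gt0.
rewrite !nderivn_def !hornerMn -[q^`N(j).[x] *+ _]mulr_natr.
rewrite -[p^`N(j).[x] *+ _]mulr_natr !mulrA -mulrBl mulrC -mulrA mulfV//.
exact: mulr1.
Qed.

Lemma nderivn_comp_oppX p j x : (p \Po (- 'X))^`N(j).[x] = (-1) ^+ j * p^`N(j).[- x].
Proof.
have fj : (j`!)%:R != 0 :> R by rewrite pnatr_eq0 -lt0n fact_gt0.
have dj i : (p \Po (- 'X))^`(i) = (-1) ^+ i *: (p^`(i) \Po (- 'X)).
  elim: i => [|i IH]; first by rewrite expr0 scale1r.
  rewrite !derivnS IH derivZ deriv_comp derivN derivX exprS.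
  by rewrite mulrN1 scalerN mulN1r scaleNr.
apply: (mulIf fj); rewrite -mulrA !mulr_natr -!hornerMn -!nderivn_def.
by rewrite dj hornerZ horner_comp hornerN hornerX.
Qed.

Lemma nderivn_horner0 p j : p^`N(j).[0] = p`_j.
Proof. by rewrite horner_coef0 coef_nderivn addn0 binn mulr1n. Qed.

Lemma coef_comp_oppX p k : (p \Po - 'X)`_k = (-1) ^+ k * p`_k.
Proof. by rewrite -[LHS]nderivn_horner0 nderivn_comp_oppX oppr0 nderivn_horner0. Qed.

Lemma signr_mul_succ j x : (-1) ^+ j.+1 * ((-1) ^+ j * x) = - x.
Proof. by rewrite exprS mulN1r mulNr mulrA -expr2 sqrr_sign mul1r. Qed.

Lemma omega_signed f p q x j delta a b : delta = 1 \/ delta = -1 -> 0 < x ->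
  a < x < b ->
  (forall y, a < y <= x -> f (delta * y) = p.[y]) ->
  (forall y, x <= y < b -> f (delta * y) = q.[y]) ->
  omega j f (delta * x) = (q - p)^`N(j).[x].
Proof.
move=> [] -> x0 axb fp fq.
  rewrite mul1r (@omegaE _ p q _ _ a b)//; first last.
  - by move=> y; rewrite in_itv/= => ?; rewrite -fq ?mul1r.
  - by move=> y; rewrite in_itv/= => ?; rewrite -fp ?mul1r.
  rewrite /sgn_right /sgn_left gt_eqF// gtr0_sg// expr1n !mul1r.
  by rewrite nderivnB hornerD hornerN.
rewrite (@omegaE _ (q \Po - 'X) (p \Po - 'X) _ _ (- b) (- a))//; first last.
- move=> y; rewrite in_itv/= => ?.
  rewrite horner_comp hornerN hornerX -fp ?mulN1r ?opprK//; lra.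
- move=> y; rewrite in_itv/= => ?.
  rewrite horner_comp hornerN hornerX -fq ?mulN1r ?opprK//; lra.
- by lra.
rewrite /sgn_right /sgn_left mulN1r lt_eqF ?oppr_lt0// ltr0_sg ?oppr_lt0//.
rewrite !nderivn_comp_oppX opprK nderivnB hornerD hornerN !signr_mul_succ.
by rewrite opprK addrC.
Qed.

Lemma omega_signed0 f p x j delta a b : delta = 1 \/ delta = -1 -> 0 < x ->
  a < x < b -> (forall y, a < y < b -> f (delta * y) = p.[y]) ->
  omega j f (delta * x) = 0.
Proof.
move=> d x0 axb fp; rewrite (@omega_signed _ p p _ _ _ a b)//.
- by rewrite subrr linear0 horner0.
- by move=> y ?; apply: fp; lra.
- by move=> y ?; apply: fp; lra.
Qed.

Lemma omega_origin f p q j a b : 0 < a -> 0 < b ->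
  (forall y, 0 <= y < a -> f y = p.[y]) ->
  (forall y, 0 <= y < b -> f (- y) = q.[y]) ->
  omega j f 0 = p`_j + q`_j.
Proof.
move=> a0 b0 fp fq; rewrite (@omegaE _ (q \Po - 'X) p _ _ (- b) a)//; first last.
- move=> y; rewrite in_itv/= => ?.
  rewrite horner_comp hornerN hornerX -fq ?opprK//; lra.
- by lra.
rewrite /sgn_right /sgn_left eqxx expr1n nderivn_comp_oppX oppr0.
by rewrite !nderivn_horner0 mul1r signr_mul_succ opprK.
Qed.
End Local.

(** * Expansion in truncated powers along a half-line *)

Section Knots.
Context {R : realType}.
Implicit Types (f g : R -> R) (p q : {poly R}) (x y z r : R) (b : int -> R).

Lemma breakpoints_reflect b : breakpoints b -> breakpoints (fun i => - b (- i)).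
Proof.
case=> binc blim; split; first by move=> i k ik; rewrite ltrN2 binc// ltrN2.
rewrite -subset0 => x xlim; suff : limit_point (range b) (- x) by rewrite blim.
move=> V; rewrite nbhsN => /xlim[y [yx [i _ iy] Vy]].
exists (- y); split => //; first by rewrite eqr_opp.
by exists (- i) => //; rewrite -iy opprK.
Qed.

(** A bounded increasing sequence of breakpoints would accumulate at its supremum. *)
Lemma breakpoints_unbounded b X : breakpoints b -> exists i, X < b i.
Proof.
case=> binc blim; apply: contrapT => bX.
have {}bX i : b i <= X by rewrite leNgt; apply/negP => ?; apply: bX; exists i.
have supb : has_sup (range b).
  by split; [exists (b 0), 0 | exists X => _ [i _ <-]].
suff : limit_point (range b) (sup (range b)) by rewrite blim.
move=> V /nbhs_ballP[e /= e0 eV].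
have [_ [i _ <-] ei] := sup_adherent e0 supb.
have lt_sup : b i < sup (range b).
  apply: (@lt_le_trans _ _ (b (i + 1))); first by apply: binc; lia.
  by apply: ub_le_sup; [case: supb | exists (i + 1)].
exists (b i); split; [by rewrite lt_eqF | by exists i | apply: eV].
by rewrite /ball/= gtr0_norm; lra.
Qed.

(** The index sought is that of the first breakpoint beyond [x], searched upward from a breakpoint
    at or to the left of [x]. *)
Lemma breakpoints_straddle b x : breakpoints b -> exists i, b (i - 1) <= x < b i.
Proof.
move=> bb; have [i xi] := breakpoints_unbounded _ x bb.
have [k] := breakpoints_unbounded _ (- x) (breakpoints_reflect _ bb).
rewrite ltrN2 => kx; have {}kx : b (- k) <= x by exact: ltW.
have ex : exists m : nat, x < b (- k + m%:Z).
  exists `|(i + k)%R|%N; have [|ik] := lerP (- k) i.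
    by move=> ki; rewrite (_ : - k + _ = i)//; lia.
  by have := bb.1 _ _ ik; move: kx xi; lra.
case: (ex_minnP ex) => m xm minm; exists (- k + m%:Z); rewrite xm andbT.
case: m xm minm => [|m] xm minm; first by rewrite addr0 in xm; lra.
rewrite leNgt; apply/negP => xlt.
suff : (m.+1 <= m)%N by rewrite ltnn.
by apply: minm; rewrite (_ : - k + m%:Z = - k + m.+1%:Z - 1)//; lia.
Qed.

Definition same_sign_tail p :=
  (forall j, (0 < j)%N -> 0 <= p`_j) \/ (forall j, (0 < j)%N -> p`_j <= 0).

Lemma same_sign_tail_sum p m a (h : nat -> nat) : same_sign_coefs m a ->
  (forall k, (0 < k)%N -> p`_k = \sum_(1 <= j < m.+1) a j *+ (k == h j)) ->
  same_sign_tail p.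
Proof.
move=> [a_ge0|a_le0] pE; [left|right] => k k0; rewrite pE//.
  by rewrite big_nat; apply: sumr_ge0 => j jm; rewrite mulrn_wge0// a_ge0.
by rewrite -oppr_ge0 -sumrN big_nat; apply: sumr_ge0 => j jm;
   rewrite -mulNrn mulrn_wge0// oppr_ge0 a_le0.
Qed.

(** The exponents have a single parity, so replacing [x] by [- x] either keeps all non-constant
    coefficients or changes all their signs. *)
Lemma well_defined_same_sign p : well_defined_poly p ->
  same_sign_tail p /\ same_sign_tail (p \Po - 'X).
Proof.
case=> [deg0|[m [a [m0 sa pE]]]].
  have p0 k : (0 < k)%N -> p`_k = 0.
    move=> k0; rewrite nth_default//; apply: leq_trans k0.
    by move: deg0; rewrite /degree; case: (size p) => [|[]].
  by split; left => k k0; rewrite ?coef_comp_oppX p0// mulr0.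
have coefE h : p - p.[0]%:P = \sum_(1 <= j < m.+1) a j *: 'X^(h j) ->
    forall k, (0 < k)%N -> p`_k = \sum_(1 <= j < m.+1) a j *+ (k == h j).
  move=> {}pE k k0; have -> : p = (p - p.[0]%:P) + p.[0]%:P by rewrite subrK.
  rewrite coefD coefC gtn_eqF// addr0 pE coef_sum.
  by apply: eq_bigr => j _; rewrite coefZ coefXn mulr_natr.
case: pE => -[_ /coefE pE]; split; [exact: same_sign_tail_sum pE| |
  exact: same_sign_tail_sum pE|].
- apply: (@same_sign_tail_sum _ m (fun j => - a j) (fun j => 2 * j - 1)%N).
    by case: sa => sa; [right|left] => j /sa; rewrite ?oppr_le0 ?oppr_ge0.
  move=> k k0; rewrite coef_comp_oppX pE// mulr_sumr !big_nat.
  apply: eq_bigr => j jm; have [->|] := eqVneq k (2 * j - 1)%N.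
    rewrite !mulr1n -signr_odd (_ : odd _ = true) ?mulN1r//; lia.
  by rewrite !mulr0n mulr0.
- apply: (@same_sign_tail_sum _ m a (fun j => 2 * j)%N) => // k k0.
  rewrite coef_comp_oppX pE// mulr_sumr !big_nat.
  apply: eq_bigr => j jm; have [->|] := eqVneq k (2 * j)%N.
    rewrite !mulr1n -signr_odd (_ : odd _ = false) ?mul1r//; lia.
  by rewrite !mulr0n mulr0.
Qed.

(** This describes [g] on [[0, +oo[] only; a function on the line is handled as the pair [f x],
    [f (- x)]. The sign condition concerns the first polynomial because its coefficients may cancel
    in [omega] at 0, whereas [omega] measures the jumps at later knots exactly. *)
Record knots n g (t : nat -> R) (p : nat -> {poly R}) : Prop := {
  knots0 : t 0%N = 0;
  knots_lt : {homo t : i j / (i < j)%N >-> i < j};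
  knots_unbounded : forall X, exists N, X < t N;
  knots_horner : forall m x, t m <= x <= t m.+1 -> g x = (p m).[x];
  knots_size : forall m, (size (p m) <= n.+1)%N;
  knots_sign : same_sign_tail (p 0%N) }.

Lemma piecewise_knots n f b P : piecewise_poly n f b P ->
  (forall i, same_sign_tail (P i)) -> 
  exists t (q : nat -> {poly R}), knots n f t q.
Proof.
move=> [bb fP [degP _]] sP; have [i0 /andP[i0_le i0_gt]] := breakpoints_straddle _ 0 bb.
(* As [b (i0 - 1) <= 0 < b i0], the point 0 cuts the segment of index [i0], which becomes the
   segment of index 0. *)
pose t (m : nat) := if m is k.+1 then b (i0 + k%:Z) else 0.
exists t, (fun m => P (i0 + m%:Z)).
have tS m : t m < t m.+1.
  by case: m => [|m] /=; [rewrite addr0 | apply: bb.1; lia].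
have tlt : {homo t : i j / (i < j)%N >-> i < j}.
  by apply: homo_ltn => [y x z|]; [exact: lt_trans | exact: tS].
split => //.
- move=> X; have [i Xi] := breakpoints_unbounded _ (Num.max X (t 1%N)) bb.
  move: Xi; rewrite gt_max => /andP[Xi ti].
  have i0i : i0 < i by rewrite ltNge; apply/negP; rewrite le_eqVlt =>
    /orP[/eqP ii0|/bb.1 ii0]; move: ti; rewrite /= addr0 ?ii0; lra.
  by exists (`|(i - i0)%R|%N.+1); rewrite /= (_ : i0 + _ = i)//; lia.
- move=> m x /andP[mx xm]; apply: fP; rewrite xm andbT.
  case: m mx {xm} => [|m] /= mx; first by rewrite addr0 (le_trans i0_le).
  by rewrite (_ : i0 + m.+1%:Z - 1 = i0 + m%:Z)//; lia.
- move=> m; have := degP (degree (P (i0 + m%:Z))).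
  rewrite /degree => sz; have {sz} : ((size (P (i0 + m%:Z)%R)).-1 <= n)%N.
    by apply: sz; exists (i0 + m%:Z).
  by case: (size _).
Qed.

(** The reflected segment from [- b (1 - i)] to [- b (- i)] comes from the one ending at
    [b (1 - i)], hence the index [1 - i]. *)
Lemma piecewise_poly_reflect n f b P : piecewise_poly n f b P ->
  piecewise_poly n (fun x => f (- x)) (fun i => - b (- i))
    (fun i => P (1 - i) \Po - 'X).
Proof.
case=> bb fP degP; split; first exact: breakpoints_reflect.
  move=> i x /andP[ix xi]; rewrite horner_comp hornerN hornerX.
  apply: fP; rewrite (_ : 1 - i - 1 = - i); last by ring.
  by rewrite (_ : 1 - i = - (i - 1)); [lra | ring].
suff -> : range (degree \o (fun i => P (1 - i) \Po - 'X)) = range (degree \o P).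
  by [].
have degX p : degree (p \Po - 'X) = degree p.
  by rewrite /degree size_comp_poly2// size_polyN size_polyX.
apply/seteqP; split=> _ [i _ <-] /=; exists (1 - i) => //=; rewrite degX//.
by rewrite opprB addrC subrK.
Qed.

Lemma well_defined_knots n f delta : well_defined_meromorphic n f ->
  delta = 1 \/ delta = -1 ->
  exists t (p : nat -> {poly R}), knots n (fun x => f (delta * x)) t p.
Proof.
case=> _ [b [P [fP wdP]]] [] ->.
  have -> : (fun x => f (1 * x)) = f by apply/funext => x; rewrite mul1r.
  apply: (piecewise_knots _ _ _ _ fP) => i.
  by case: (well_defined_same_sign _ (wdP i)).
have -> : (fun x => f (-1 * x)) = (fun x => f (- x)).
  by apply/funext => x; rewrite mulN1r.
apply: (piecewise_knots _ _ _ _ (piecewise_poly_reflect _ _ _ _ fP)) => i.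
by case: (well_defined_same_sign _ (wdP (1 - i))).
Qed.

(* At the knot [t 0 = 0] this is the coefficient of ['X^j] in [p 0]. *)
Definition knot_jump (p : nat -> {poly R}) (t : nat -> R) (m j : nat) : R :=
  (p m - if m is k.+1 then p k else 0)^`N(j).[t m].

(** The orders start at 1: adjacent polynomials take the same value at their common knot, so there
    is no jump of order 0, and the constant [g 0] is kept apart. *)
Definition knot_sum n (t : nat -> R) (F : nat -> nat -> R) (N : nat) r : R :=
  \sum_(m < N) \sum_(1 <= j < n.+1) F m j * Num.max (r - t m) 0 ^+ j.

Lemma taylor_from1 n q x r : (size q <= n.+1)%N ->
  q.[r] = q.[x] + \sum_(1 <= j < n.+1) q^`N(j).[x] * (r - x) ^+ j.
Proof.
move=> sq; rewrite -{1}(subrK x r) addrC (nderiv_taylor_wide _ sq); last exact: mulrC.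
rewrite big_ord_recl nderivn0 expr0 mulr1; congr (_ + _).
by rewrite big_add1 big_mkord; apply: eq_bigr.
Qed.

Section KnotSum.
Context (n : nat) (g : R -> R) (t : nat -> R) (p : nat -> {poly R}).
Context (gtp : knots n g t p).

Lemma knots_le i j : (i <= j)%N -> t i <= t j.
Proof.
by rewrite leq_eqVlt => /predU1P[->//|/(knots_lt _ _ _ _ gtp)/ltW].
Qed.

Lemma knots_ge0 i : 0 <= t i.
Proof. by rewrite -(knots0 _ _ _ _ gtp); exact: knots_le. Qed.

(** The powers are not truncated here, as [p N] is evaluated at any [r]. The induction adds the
    Taylor expansion of [p N.+1 - p N] at their common knot, where this difference vanishes. *)
Lemma knots_horner_sum N r : (p N).[r] =
  g 0 + \sum_(m < N.+1) \sum_(1 <= j < n.+1) knot_jump p t m j * (r - t m) ^+ j.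
Proof.
elim: N => [|N IH].
  rewrite big_ord1 /knot_jump subr0 (knots0 _ _ _ _ gtp).
  rewrite (taylor_from1 _ _ 0 r (knots_size _ _ _ _ gtp 0%N)).
  rewrite (knots_horner _ _ _ _ gtp 0%N)// (knots0 _ _ _ _ gtp) lexx.
  exact: knots_ge0.
rewrite big_ord_recr/= addrA -IH /knot_jump.
rewrite -[LHS](subrK (p N).[r]) addrC -hornerN -hornerD; congr (_ + _).
rewrite (taylor_from1 n _ (t N.+1)); last first.
  rewrite (leq_trans (size_polyD _ _))// geq_max size_polyN.
  by rewrite !(knots_size _ _ _ _ gtp).
rewrite hornerD hornerN -!(knots_horner _ _ _ _ gtp) ?lexx ?knots_le//.
by rewrite subrr add0r.
Qed.

Lemma knots_locate x N : 0 <= x < t N ->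
  exists2 m, (m < N)%N & t m <= x < t m.+1.
Proof.
elim: N => [|N IH]; first by rewrite (knots0 _ _ _ _ gtp); lra.
move=> /andP[x0 xN]; have [Nx|xN'] := lerP (t N) x.
  by exists N; rewrite ?Nx.
have [|m mN mx] := IH; first by rewrite x0.
by exists m => //; exact: ltnW.
Qed.

(** Truncated powers based at knots beyond [r] vanish, since [j >= 1] excludes [0 ^+ 0 = 1]. *)
Lemma knot_sum_stable (F : nat -> nat -> R) N M r : (N <= M)%N -> r <= t N ->
  knot_sum n t F M r = knot_sum n t F N r.
Proof.
move=> NM rN; rewrite /knot_sum -!(big_mkord xpredT (fun m =>
  \sum_(1 <= j < n.+1) F m j * Num.max (r - t m) 0 ^+ j)).
rewrite (big_cat_nat (leq0n N) NM)/= [X in _ + X]big_nat [X in _ + X]big1 ?addr0// => m.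
case/andP=> Nm _; rewrite big_nat big1// => j /andP[j0 _].
rewrite max_r ?expr0n ?gtn_eqF ?mulr0//.
by rewrite subr_le0 (le_trans rN)// knots_le.
Qed.

Lemma knots_eq_sum N r : 0 <= r <= t N ->
  g r = g 0 + knot_sum n t (knot_jump p t) N r.
Proof.
(* On the segment of index [M] no truncation at the knots up to [t M] is active, so the sum is the
   expansion of [p M]. *)
have pE M s : t M <= s <= t M.+1 ->
    g s = g 0 + knot_sum n t (knot_jump p t) M.+1 s.
  move=> /andP[Mr rM]; rewrite (knots_horner _ _ _ _ gtp M) ?Mr//.
  rewrite knots_horner_sum; congr (_ + _); apply: eq_bigr => m _.
  apply: eq_bigr => j _; rewrite max_l// subr_ge0 (le_trans _ Mr)//.
  by apply: knots_le; rewrite -ltnS.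
move=> /andP[r0]; rewrite le_eqVlt => /predU1P[->|rN].
  by rewrite -(knot_sum_stable _ N N.+1)// -pE// lexx knots_le.
have [|m mN /andP[mr rm]] := knots_locate r N; first by rewrite r0.
by rewrite (knot_sum_stable _ m.+1 N) ?(ltW rm)// -pE// mr ltW.
Qed.
End KnotSum.
End Knots.

(** * The majorant and the characteristic *)

Section Growth.
Context {R : realType}.
Implicit Types (f g : R -> R) (x r : R) (t : nat -> R) (p : nat -> {poly R}).

Definition knot_variation n t p N r : R :=
  knot_sum n t (fun m j => `|knot_jump p t m j|) N r.

Lemma maxB_pow_le (a b : R) (j : nat) : a <= b ->
  Num.max a 0 ^+ j <= Num.max b 0 ^+ j.
Proof.
have max_ge0 (c : R) : Num.max c 0 \is Num.nneg by rewrite nnegrE le_max lexx orbT.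
by move=> ab; apply: lerXn2r; rewrite ?max_ge0// ge_max !le_max ab lexx orbT.
Qed.

Lemma knot_variation_ge n t p N r1 r2 : r2 <= r1 ->
  `|knot_sum n t (knot_jump p t) N r1 - knot_sum n t (knot_jump p t) N r2| <=
  knot_variation n t p N r1 - knot_variation n t p N r2.
Proof.
move=> r21; rewrite /knot_variation /knot_sum -!sumrB.
apply: le_trans (ler_norm_sum _ _ _) _; apply: ler_sum => m _.
rewrite -!sumrB; apply: le_trans (ler_norm_sum _ _ _) _; apply: ler_sum => j _.
rewrite -!mulrBr normrM ler_wpM2l// ger0_norm// subr_ge0.
by apply: maxB_pow_le; rewrite lerD2r.
Qed.

(** Each truncated power grows at least linearly: [lambda * (r - t) <= lambda * r - t] for [t >= 0],
    and [lambda <= lambda ^ j] for [j >= 1]. *)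
Lemma knot_variation_scale n g t p N r lambda : knots n g t p -> 1 <= lambda ->
  lambda * knot_variation n t p N r <= knot_variation n t p N (lambda * r).
Proof.
move=> gtp l1; have l0 : 0 <= lambda by lra.
rewrite /knot_variation /knot_sum mulr_sumr; apply: ler_sum => m _.
rewrite mulr_sumr !big_nat; apply: ler_sum => j /andP[j0 _].
rewrite mulrCA ler_wpM2l//.
have tm0 := knots_ge0 _ _ _ _ gtp m.
apply: (@le_trans _ _ ((lambda * Num.max (r - t m) 0) ^+ j)).
  rewrite exprMn ler_wpM2r ?exprn_ge0 ?le_max ?lexx ?orbT//.
  by rewrite -{1}[lambda]expr1; apply: ler_weXn2l.
rewrite maxr_pMr// mulr0; apply: maxB_pow_le.
by rewrite mulrBr lerD2l lerN2; apply: ler_peMl.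
Qed.

Lemma variation_exists n g t p : knots n g t p ->
  exists U : R -> R, forall N r, 0 <= r <= t N -> U r = knot_variation n t p N r.
Proof.
move=> gtp; pose N r := sval (cid (knots_unbounded _ _ _ _ gtp r)).
have rN r : r <= t (N r) by rewrite /N; case: cid => /= M /ltW.
exists (fun r => knot_variation n t p (N r) r) => M r /andP[_ rM].
rewrite /knot_variation; have [NM|/ltnW MN] := leqP (N r) M.
  by rewrite [RHS](knot_sum_stable _ _ _ _ gtp _ (N r) M).
by rewrite [LHS](knot_sum_stable _ _ _ _ gtp _ M (N r)).
Qed.

Lemma omega_knot n f delta t p m j : delta = 1 \/ delta = -1 ->
  knots n (fun x => f (delta * x)) t p ->
  omega j f (delta * t m.+1) = knot_jump p t m.+1 j.
Proof.
move=> d ftp; have tlt := knots_lt _ _ _ _ ftp.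
apply: (omega_signed _ _ _ _ _ _ (t m) (t m.+2)) => //.
- by rewrite -(knots0 _ _ _ _ ftp) tlt.
- by rewrite !tlt.
- by move=> y my; apply: (knots_horner _ _ _ _ ftp); lra.
- by move=> y my; apply: (knots_horner _ _ _ _ ftp); lra.
Qed.

Lemma omega_off_knots n f delta t p x j N : delta = 1 \/ delta = -1 ->
  knots n (fun x => f (delta * x)) t p -> 0 < x < t N ->
  (forall m, (0 < m < N)%N -> x != t m) -> omega j f (delta * x) = 0.
Proof.
move=> d ftp /andP[x0 xN] xt.
have [|m mN /andP[mx xm]] := knots_locate _ _ _ _ ftp x N; first by rewrite ltW.
have {}mx : t m < x.
  rewrite lt_neqAle mx andbT eq_sym.
  case: m mN {mx xm} => [|m] mN; last by rewrite xt.
  by rewrite (knots0 _ _ _ _ ftp) gt_eqF.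
apply: (omega_signed0 _ (p m) _ _ _ (t m) (t m.+1)) => //; first by rewrite mx.
by move=> y my; apply: (knots_horner _ _ _ _ ftp); lra.
Qed.

Definition negpart x : R := Num.max (- x) 0.

(** Up to the factor [1/2], this is the share of one open half-line in [counting]. The knot 0 is
    left out because the two half-lines meet there and their coefficients add up. *)
Definition side_counting t p N r j : R :=
  \sum_(1 <= m < N) negpart (knot_jump p t m j) * Num.max (r - t m) 0 ^+ j.

Lemma counting_knots n f t p t' p' N r j :
  knots n (fun x => f (1 * x)) t p -> knots n (fun x => f (-1 * x)) t' p' ->
  (0 < j)%N -> 0 < r -> r <= t N -> r <= t' N ->
  Defs.counting j r f =
    2^-1 * (negpart ((p 0%N)`_j + (p' 0%N)`_j) * r ^+ j +
            (side_counting t p N r j + side_counting t' p' N r j)).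
Proof.
move=> ftp ftp' j0 r0 rt rt'; rewrite /Defs.counting; congr (_ * _).
have d1 : (1 : R) = 1 \/ 1 = -1 :> R by left.
have d2 : (-1 : R) = 1 \/ -1 = -1 :> R by right.
have t_gt0 m : (0 < m)%N -> 0 < t m.
  by rewrite -(knots0 _ _ _ _ ftp); exact: (knots_lt _ _ _ _ ftp).
have t'_gt0 m : (0 < m)%N -> 0 < t' m.
  by rewrite -(knots0 _ _ _ _ ftp'); exact: (knots_lt _ _ _ _ ftp').
(* All possible poles in []- r, r[] are in this list. *)
pose s := 0 :: [seq t m | m <- index_iota 1 N] ++ [seq - t' m | m <- index_iota 1 N].
pose A := [set z | pole j f z /\ - r < z < r].
pose F z := `|omega j f z| * (r - `|z|) ^+ j.
have us : uniq s.
  have tinj (u : nat -> R) : {homo u : i k / (i < k)%N >-> i < k} -> injective u.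
    by move=> ulti a b uab; case: (ltngtP a b) => // /ulti; rewrite uab ltxx.
  rewrite /s cons_uniq cat_uniq !map_inj_uniq ?iota_uniq; first last.
  - by apply: tinj; exact: knots_lt ftp.
  - by move=> a b /oppr_inj; apply: tinj; exact: knots_lt ftp'.
  rewrite !andbT /=; apply/andP; split.
    apply/negP; rewrite mem_cat => /orP[] /mapP[m]; rewrite mem_index_iota.
      by move=> /andP[/t_gt0 + _] tm; rewrite -tm ltxx.
    by move=> /andP[/t'_gt0 + _] /eqP; rewrite eq_sym oppr_eq0 => + /eqP tm; rewrite tm ltxx.
  apply/hasPn => _ /mapP[m + ->]; rewrite mem_index_iota => /andP[/t'_gt0 m0 _].
  apply/negP => /mapP[k]; rewrite mem_index_iota => /andP[/t_gt0 k0 _]; lra.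
have As z : A z -> z \in s.
  case=> polez zr; apply: contrapT => /negP.
  rewrite inE mem_cat !negb_or => /and3P[z0 zt zt'].
  suff w0 : omega j f z = 0 by move: polez; rewrite /pole w0 ltxx.
  have [zlt|zgt|/esym zE] := ltrgtP z 0; last by rewrite zE eqxx in z0.
    rewrite -[z]opprK -mulN1r; apply: (omega_off_knots _ _ _ _ _ _ _ N d2 ftp').
      by lra.
    move=> m mN; apply: contra zt' => /eqP zm; apply/mapP; exists m.
      by rewrite mem_index_iota.
    by rewrite -zm opprK.
  rewrite -[z]mul1r; apply: (omega_off_knots _ _ _ _ _ _ _ N d1 ftp).
    by lra.
  move=> m mN; apply: contra zt => /eqP zm; apply/mapP; exists m => //.
  by rewrite mem_index_iota.
(* The sum may run over the whole list: [negpart] kills the points that are not poles and the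
   truncation those outside []- r, r[]. *)
transitivity (\sum_(z <- s) negpart (omega j f z) * Num.max (r - `|z|) 0 ^+ j).
  have -> : \sum_(z \in A) F z = \sum_(z <- s | z \in A) F z.
    rewrite [RHS]bigfs ?set_mem_set// => z; rewrite inE => /As.
    by move=> ->.
  rewrite big_mkcond; apply: eq_bigr => z _; rewrite /negpart /F /=.
  case: ifPn => [/set_mem[polez zr]|/negP nAz].
    rewrite max_l; last by rewrite oppr_ge0 ltW.
    rewrite (ltr0_norm polez) max_l// subr_ge0 ler_norml.
    by case/andP: zr => /ltW -> /ltW ->.
  have [zr|rz] := ltrP `|z| r.
    rewrite [X in X * _]max_r ?mul0r// oppr_le0 leNgt; apply/negP => polez.
    by apply: nAz; apply/mem_set; split; rewrite // -ltr_norml.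
  by rewrite [X in X ^+ _]max_r ?subr_le0// expr0n gtn_eqF// mulr0.
rewrite /s big_cons big_cat !big_map /=; congr (_ + (_ + _)).
- rewrite normr0 subr0 max_l ?ltW//.
  rewrite (omega_origin _ (p 0%N) (p' 0%N) _ (t 1%N) (t' 1%N)) ?t_gt0 ?t'_gt0//.
    move=> y y1; rewrite -(knots_horner _ _ _ _ ftp 0%N) ?mul1r//.
    by rewrite (knots0 _ _ _ _ ftp); lra.
  move=> y y1; rewrite -(knots_horner _ _ _ _ ftp' 0%N) ?mulN1r//.
  by rewrite (knots0 _ _ _ _ ftp'); lra.
- rewrite /side_counting big_nat [RHS]big_nat; apply: eq_bigr => m /andP[m0 _].
  rewrite gtr0_norm ?t_gt0//; case: m m0 => // m _.
  by rewrite -[t m.+1]mul1r (omega_knot _ _ _ _ _ _ _ d1 ftp) mul1r.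
- rewrite /side_counting big_nat [RHS]big_nat; apply: eq_bigr => m /andP[m0 _].
  rewrite normrN gtr0_norm ?t'_gt0//; case: m m0 => // m _.
  by rewrite -[- t' m.+1]mulN1r (omega_knot _ _ _ _ _ _ _ d2 ftp').
Qed.

Lemma knot_sum_split n g t p (F : nat -> nat -> R) N r : knots n g t p ->
  (0 < N)%N -> 0 <= r ->
  knot_sum n t F N r = \sum_(1 <= j < n.+1) F 0%N j * r ^+ j +
    \sum_(1 <= j < n.+1) \sum_(1 <= m < N) F m j * Num.max (r - t m) 0 ^+ j.
Proof.
move=> gtp N0 r0; rewrite /knot_sum -(big_mkord xpredT (fun m =>
  \sum_(1 <= j < n.+1) F m j * Num.max (r - t m) 0 ^+ j)) big_ltn//.
rewrite (knots0 _ _ _ _ gtp) subr0 max_l//; congr (_ + _).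
by rewrite exchange_big_nat.
Qed.

(** For [r >= 0] all terms have one sign, so nothing cancels. This is how a bound on the value at
    [r] of the initial polynomial controls all its coefficients at once. *)
Lemma same_sign_tail_norm n (q : {poly R}) r : same_sign_tail q -> 0 <= r ->
  \sum_(1 <= j < n.+1) `|q`_j| * r ^+ j =
  `|\sum_(1 <= j < n.+1) q`_j * r ^+ j|.
Proof.
move=> sq r0; have rj j : 0 <= r ^+ j by exact: exprn_ge0.
case: sq => sq.
  rewrite ger0_norm; last by rewrite big_nat; apply: sumr_ge0 => j /andP[j0 _];
    rewrite mulr_ge0// sq.
  by rewrite !big_nat; apply: eq_bigr => j /andP[j0 _]; rewrite ger0_norm// sq.
rewrite ler0_norm -?sumrN; last first.
  rewrite -oppr_ge0 -sumrN big_nat; apply: sumr_ge0 => j /andP[j0 _].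
  by rewrite -mulNr mulr_ge0// oppr_ge0 sq.
by rewrite !big_nat; apply: eq_bigr => j /andP[j0 _]; rewrite ler0_norm ?sq// mulNr.
Qed.

Lemma negpart_ge0 x : 0 <= negpart x.
Proof. by rewrite /negpart le_max lexx orbT. Qed.

Lemma norm_negpart x : `|x| = x + 2 * negpart x.
Proof.
rewrite /negpart; have [x0|x0] := ger0P x.
  by rewrite max_r ?oppr_le0// mulr0 addr0.
rewrite max_l; last by rewrite oppr_ge0 ltW.
ring.
Qed.

(** Here [a] is the part of the expansion carried by the knot 0, [v] the part carried by the
    positive knots, and [c] counts poles. By [norm_negpart], replacing coefficients by their
    absolute values turns [v] into [v + 2 * c]. *)
Lemma side_expansion n g t p N r : knots n g t p -> (0 < N)%N -> 0 <= r <= t N ->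
  let a := \sum_(1 <= j < n.+1) (p 0%N)`_j * r ^+ j in
  let c := \sum_(1 <= j < n.+1) side_counting t p N r j in
  let v := g r - g 0 - a in
  [/\ knot_variation n t p N r = `|a| + (v + 2 * c), `|v| <= v + 2 * c & 0 <= c].
Proof.
move=> gtp N0 /andP[r0 rN] a c v.
have jump0 j : knot_jump p t 0%N j = (p 0%N)`_j.
  by rewrite /knot_jump subr0 (knots0 _ _ _ _ gtp) nderivn_horner0.
have pos_ge0 m j : 0 <= Num.max (r - t m) 0 ^+ j :> R.
  by rewrite exprn_ge0// le_max lexx orbT.
have vE : v = \sum_(1 <= j < n.+1) \sum_(1 <= m < N)
    knot_jump p t m j * Num.max (r - t m) 0 ^+ j.
  rewrite /v (knots_eq_sum _ _ _ _ gtp N) ?r0// (knot_sum_split _ _ _ _ _ _ _ gtp)//.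
  by under eq_bigr do rewrite jump0; rewrite -/a; ring.
have absE : v + 2 * c = \sum_(1 <= j < n.+1) \sum_(1 <= m < N)
    `|knot_jump p t m j| * Num.max (r - t m) 0 ^+ j.
  rewrite vE /c mulr_sumr -big_split; apply: eq_bigr => j _ /=.
  rewrite /side_counting mulr_sumr -big_split; apply: eq_bigr => m _ /=.
  by rewrite norm_negpart [RHS]mulrDl mulrA.
split.
- rewrite /knot_variation (knot_sum_split _ _ _ _ _ _ _ gtp)// absE.
  congr (_ + _); under eq_bigr do rewrite jump0.
  by apply: same_sign_tail_norm => //; exact: knots_sign gtp.
- rewrite absE vE; apply: le_trans (ler_norm_sum _ _ _) _; apply: ler_sum => j _.
  apply: le_trans (ler_norm_sum _ _ _) _; apply: ler_sum => m _.
  by rewrite normrM [X in _ * X]ger0_norm.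
- rewrite /c /side_counting; apply: sumr_ge0 => j _; apply: sumr_ge0 => m _.
  by rewrite mulr_ge0// negpart_ge0.
Qed.

(** The sum of the two expansions is Jensen's formula, [f r + f (- r) = 2 * f 0 + (a + a') + (v +
    v')], where [v >= - c], [v' >= - c'] and [a + a' >= - b], with [b] counting the poles at the
    origin. It bounds [- f r], [- f (- r)], [v] and [v'] from above by the terms of the
    characteristic and [f 0]. *)
Lemma variation_le_characteristic n f t p t' p' N r :
  knots n (fun x => f (1 * x)) t p -> knots n (fun x => f (-1 * x)) t' p' ->
  (0 < N)%N -> 0 < r -> r <= t N -> r <= t' N ->
  [/\ 0 <= characteristic n r f,
    knot_variation n t p N r <= 12 * characteristic n r f + 7 * `|f 0| &
    knot_variation n t' p' N r <= 12 * characteristic n r f + 7 * `|f 0|].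
Proof.
move=> ftp ftp' N0 r0 rt rt'.
have rt0 : 0 <= r <= t N by rewrite ltW.
have rt0' : 0 <= r <= t' N by rewrite ltW.
have := side_expansion _ _ _ _ _ _ ftp N0 rt0.
have := side_expansion _ _ _ _ _ _ ftp' N0 rt0'.
rewrite /= !mul1r !mulr0 mulN1r.
set a := \sum_(1 <= j < n.+1) (p 0%N)`_j * r ^+ j.
set a' := \sum_(1 <= j < n.+1) (p' 0%N)`_j * r ^+ j.
set c := \sum_(1 <= j < n.+1) side_counting t p N r j.
set c' := \sum_(1 <= j < n.+1) side_counting t' p' N r j.
pose b := \sum_(1 <= j < n.+1) negpart ((p 0%N)`_j + (p' 0%N)`_j) * r ^+ j.
case=> -> v'le c'0 [-> vle c0].
have -> : characteristic n r f = proximity r f + 2^-1 * (b + (c + c')).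
  congr (_ + _); rewrite /b /c /c' -!big_split mulr_sumr /=.
  rewrite big_nat [RHS]big_nat; apply: eq_bigr => j /andP[j0 _].
  exact: (counting_knots _ _ _ _ _ _ _ _ _ ftp ftp' j0 r0 rt rt').
have rj j : 0 <= r ^+ j by rewrite exprn_ge0// ltW.
have b0 : 0 <= b by apply: sumr_ge0 => j _; rewrite mulr_ge0 ?negpart_ge0.
have ba : - (a + a') <= b.
  rewrite -big_split -sumrN; apply: ler_sum => j _ /=.
  by rewrite -mulrDl -mulNr ler_wpM2r// /negpart le_max lexx.
move: v'le vle c'0 c0 b0 ba; rewrite /proximity.
move: (f r) (f (- r)) (f 0) => fr fr' f0.
have maxP (y : R) : y <= Num.max y 0 /\ 0 <= Num.max y 0 by rewrite !le_max !lexx orbT.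
have := maxP fr; have := maxP fr'.
have := ler_norm f0; have := ler_norm (- f0); rewrite normrN.
have normv (y m : R) : `|y| <= m -> - m <= y <= m by rewrite ler_norml.
have max_norm (y : R) : `|y| = 2 * Num.max y 0 - y.
  by case: (ger0P y) => y0; lra.
move=> f01 f02 [m1 m2] [m3 m4] v'le vle c0 c0' b0 ba.
have /andP[v1 v2] := normv _ _ vle; have /andP[v3 v4] := normv _ _ v'le.
(* Applied to [f r], [f 0] and [a], this recovers [a], since [f r - f 0 - a] is [v]. *)
have norma (x y z : R) : `|z| <= `|x| + `|y| + `|x - y - z|.
  have {1}-> : z = x - y - (x - y - z) by ring.
  by rewrite (le_trans (ler_normB _ _))// lerD2r ler_normB.
have := norma fr f0 a; have := norma fr' f0 a'.
have := normr_ge0 fr; have := normr_ge0 fr'; 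
rewrite (max_norm fr) (max_norm fr').
by split; lra.
Qed.
End Growth.

(** * Growth outside a set of finite logarithmic measure *)

Section Borel.
Context {R : realType}.
Implicit Types (x y d q r h s tau B C eps sigma : R).

(** Bernoulli's inequality, from concavity of [ln]: the tangent of [ln] at [w], taken at [u] and 1
    with weights [q] and [1 - q], has no linear remainder because [w] is their weighted mean. *)
Lemma powR_le_affine u q : 0 < u -> 0 <= q <= 1 -> u `^ q <= 1 + q * (u - 1) :> R.
Proof.
move=> u0 /andP[q0 q1]; set w := 1 + q * (u - 1).
have w0 : 0 < w.
  rewrite /w; have [->|qn1] := eqVneq q 1; first by lra.
  have : q < 1 by rewrite lt_neqAle qn1.
  by have := mulr_ge0 q0 (ltW u0); lra.
have ln_le v : 0 < v -> ln v <= ln w + (v / w - 1).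
  move=> v0; have vw : 0 < v / w by rewrite divr_gt0.
  have -> : ln v = ln w + ln (v / w).
    by rewrite -lnM ?posrE//; congr ln; field; rewrite gt_eqF.
  by rewrite lerD2l; have := @le_ln1Dx R (v / w - 1); rewrite addrCA subrr addr0; apply; lra.
rewrite /powR gt_eqF// -[leRHS]lnK ?posrE// ler_expR.
have := ler_wpM2l q0 (ln_le _ u0).
have q1' : 0 <= 1 - q by lra.
have := ler_wpM2l q1' (ln_le _ ltr01); rewrite ln1.
have : q * (u / w - 1) + (1 - q) * (1 / w - 1) = 0.
  by rewrite /w; field; rewrite gt_eqF.
by lra.
Qed.

(** With [u = y / (y + d)], the drop is [y ^ (- q) * (1 - u ^ q)], at least
    [y ^ (- q) * q * (1 - u)]; and [d <= y] gives [1 - u >= d / (2 * y)]. *)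
Lemma powR_inv_drop y d q : 0 < y -> 0 <= d <= y -> 0 <= q <= 1 ->
  q * d / 2 * (y * y `^ q)^-1 <= (y `^ q)^-1 - ((y + d) `^ q)^-1.
Proof.
move=> y0 /andP[d0 dy] q01; have /andP[q0 _] := q01.
have yd0 : 0 < y + d by lra.
pose u := y / (y + d); have u0 : 0 < u by rewrite divr_gt0.
have yE : y `^ q = u `^ q * (y + d) `^ q.
  by rewrite -powRM ?ltW// divfK// gt_eqF.
have Y0 : 0 < y `^ q by rewrite powR_gt0.
have Z0 : 0 < (y + d) `^ q by rewrite powR_gt0.
have -> : ((y + d) `^ q)^-1 = (y `^ q)^-1 * u `^ q.
  rewrite yE invfM mulrAC mulVf ?mul1r//.
  by rewrite gt_eqF// powR_gt0.
rewrite invfM [_^-1 * (y `^ q)^-1]mulrC mulrCA -{2}[(y `^ q)^-1]mulr1 -mulrBr.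
rewrite ler_wpM2l ?invr_ge0 ?(ltW Y0)//.
have uE : 1 - u = d / (y + d) by rewrite /u; field; rewrite gt_eqF.
have : d / (2 * y) <= 1 - u.
  by rewrite uE ler_wpM2l// lef_pV2 ?posrE; lra.
move=> /(ler_wpM2l q0).
have -> : q * (d / (2 * y)) = q * d / 2 * y^-1 by field; rewrite gt_eqF.
by have := powR_le_affine u q u0 q01; lra.
Qed.

Lemma ln1D_ge x : 0 <= x <= 1 -> x / 2 <= ln (1 + x).
Proof.
move=> /andP[x0 x1]; have x1_gt0 : 0 < 1 + x by lra.
have -> : ln (1 + x) = - ln (1 + - (x / (1 + x))).
  rewrite (_ : 1 + - (x / (1 + x)) = (1 + x)^-1); last by field; rewrite gt_eqF.
  by rewrite lnV ?posrE// opprK.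
have := @le_ln1Dx R (- (x / (1 + x))).
have : x / 2 <= x / (1 + x) by rewrite ler_wpM2l// lef_pV2 ?posrE; lra.
have : x / (1 + x) < 1 by rewrite ltr_pdivrMr; lra.
by lra.
Qed.

(** For [y = ln u_k], [z = ln u_(k+3)] and [K = k+1]. The jump is at least [K ^ (a - 1) / 2], while
    [y ^ (1 + q)] is at most a constant times [K ^ a]; as [a = tau * (1 + q)], the two powers
    combine to [1 / K]. The 4 collects the halves lost in [ln1D_ge] and [powR_inv_drop]. *)
Lemma log_jump_le q a B h tau y z K : 0 < q <= 1 -> 0 < B -> 0 < h -> 1 <= K ->
  tau * (1 + q) = a -> 0 <= a <= 1 -> 1 <= y -> y <= B * (K * h) `^ tau ->
  y + ln (1 + (K `^ (1 - a))^-1) <= z ->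
  K^-1 <= 4 * (B `^ (1 + q) * h `^ a) / q * ((y `^ q)^-1 - (z `^ q)^-1).
Proof.
move=> /andP[q0 q1] B0 h0 K1 aE /andP[a0 a1] y1 yB yz.
set x := (K `^ (1 - a))^-1 in yz.
have K0 : 0 < K by lra.
have Ks1 : 1 <= K `^ (1 - a) by rewrite -[leLHS](powRr0 K) ler_powR//; lra.
have x0 : 0 < x by rewrite invr_gt0; lra.
have x1 : x <= 1 by rewrite invf_le1; lra.
set d := ln (1 + x) in yz.
have xd : x / 2 <= d by rewrite ln1D_ge// x1 ltW.
have d1 : d <= 1 by rewrite (le_trans (le_ln1Dx _))//; lra.
have q0' : 0 <= q <= 1 by rewrite ltW.
have := @powR_inv_drop y d q; rewrite q0'.
have -> : 0 < y by lra.
have -> : 0 <= d <= y by lra.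
move=> /(_ isT isT isT) drop.
have yy : y * y `^ q <= B `^ (1 + q) * h `^ a * K `^ a.
  have -> : y * y `^ q = y `^ (1 + q).
    by rewrite powRD ?powRr1//; [lra | apply/implyP => _; rewrite gt_eqF//; lra].
  have -> : B `^ (1 + q) * h `^ a * K `^ a = (B * (K * h) `^ tau) `^ (1 + q).
    rewrite powRM ?powR_ge0 ?ltW// -powRrM aE powRM ?ltW//; ring.
  by apply: ge0_ler_powR; rewrite ?nnegrE//; [lra | lra | rewrite mulr_ge0 ?powR_ge0// ltW].
set D := B `^ (1 + q) * h `^ a in yy *.
have D0 : 0 < D by rewrite mulr_gt0 ?powR_gt0.
have KE : K^-1 = x * (K `^ a)^-1.
  rewrite /x -invfM -powRD ?subrK ?powRr1//; first by rewrite ltW.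
  by apply/implyP => _; rewrite gt_eqF.
have yq0 : 0 < y `^ q by rewrite powR_gt0; lra.
have zq : ((y + d) `^ q)^-1 >= (z `^ q)^-1.
  rewrite lef_pV2 ?posrE ?powR_gt0//; try lra.
  by apply: ge0_ler_powR; rewrite ?nnegrE//; lra.
have c0 : 0 <= 4 * D / q by rewrite divr_ge0 ?(ltW q0)// mulr_ge0 ?(ltW D0).
apply: (@le_trans _ _ (4 * D / q * (q * d / 2 * (y * y `^ q)^-1))); last first.
  by rewrite ler_wpM2l//; lra.
have -> : 4 * D / q * (q * d / 2 * (y * y `^ q)^-1) = 2 * d * (D * (y * y `^ q)^-1).
  by field; rewrite ?gt_eqF//; lra.
rewrite KE; apply: ler_pM; rewrite ?invr_ge0 ?powR_ge0 ?(ltW x0)//; first by lra.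
have Ka0 : 0 < K `^ a by rewrite powR_gt0.
rewrite -[leLHS]mul1r ler_pdivrMr// mulrAC ler_pdivlMr ?mul1r//.
by rewrite mulr_gt0//; lra.
Qed.
End Borel.

(** * The exceptional set and its logarithmic measure *)

Section LogMeasure.
Context {R : realType}.
Implicit Types (q r h s tau B C eps sigma : R).

(** The intervals are disjoint, of length [h], and [1 / r] is at most [1 / ((k+1) * h)] on the one
    of index [k], which therefore contributes at most [1 / (k+1)]. *)
Lemma finite_log_measure_bigcup h (bad : pred nat) (M : R) : 0 < h ->
  (forall N, \sum_(k < N | bad k) k.+1%:R^-1 <= M :> R) ->
  finite_log_measure
    (\bigcup_(k in [set k | bad k]) ([set` `[k.+1%:R * h, k.+2%:R * h[] : set R)).
Proof.
move=> h0 sumM; pose I k : set R := [set` `[k.+1%:R * h, k.+2%:R * h[].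
pose F k : set R := if bad k then I k else set0.
have -> : \bigcup_(k in [set k | bad k]) I k = \bigcup_k F k.
  apply/seteqP; split=> [x [k /= bk Ikx]|x [k _]].
    by exists k => //; rewrite /F bk.
  by rewrite /F; case: ifP => // bk Ikx; exists k.
have mI k : measurable (I k) by exact: measurable_itv.
have mF k : measurable (F k) by rewrite /F; case: ifP => _; [exact: mI|exact: measurable0].
have mE : measurable (\bigcup_k F k) by exact: bigcup_measurable.
have F_gt0 k x : F k x -> 0 < x.
  rewrite /F; case: ifP => // _; rewrite /I/= in_itv/= => /andP[+ _].
  by apply: lt_le_trans; rewrite mulr_gt0.
split=> //; first by move=> x [k _ /F_gt0].
have minv (D : set R) : measurable D -> D `<=` [set x | 0 < x] ->
    measurable_fun D (EFin \o (fun x : R => x^-1)).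
  move=> mD D0; apply/measurable_EFinP.
  apply: (eq_measurable_fun (fun x : R => x `^ (-1))).
    by move=> x /set_mem/D0/= x0; rewrite powR_inv1// ltW.
  by apply: measurable_funS (measurable_powR (-1)).
have inv_ge0 (x : R) : (\bigcup_k F k) x -> (0 <= x^-1%:E)%E.
  by move=> [k _ /F_gt0 x0]; rewrite lee_fin invr_ge0 ltW.
have mEinv : measurable_fun (\bigcup_k F k) (EFin \o (fun x : R => x^-1)).
  by apply: minv => // x [k _ /F_gt0].
apply: (@le_lt_trans _ _ (\int[lebesgue_measure]_(r in \bigcup_k F k) (r^-1)%:E)%E).
  apply: ge0_subset_integral => //; exact: measurableI.
have triv : trivIset setT F.
  apply/trivIsetP => i j _ _ ij; rewrite -subset0 => x [].
  rewrite /F; case: ifP => // _; case: ifP => // _.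
  rewrite /I/= !in_itv/= => /andP[ix xi] /andP[jx xj].
  have lij (a b : nat) : a.+1%:R * h <= x -> x < b.+2%:R * h -> (a <= b)%N.
    move=> ax xb; have := le_lt_trans ax xb.
    by rewrite ltr_pM2r// ltr_nat !ltnS.
  have := lij _ _ ix xj; have := lij _ _ jx xi => ji ij'.
  by move: ij; rewrite eqn_leq ij' ji.
rewrite ge0_integral_bigcup//.
apply: (@le_lt_trans _ _ M%:E); last exact: ltry.
apply: lime_le.
  by apply: is_cvg_nneseries => k _ _; apply: integral_ge0 => x Fx; apply: inv_ge0; exists k.
apply: nearW => N; apply: (@le_trans _ _ (\sum_(0 <= k < N) (if bad k then k.+1%:R^-1 else 0)%:E)%E); last first.
  by rewrite sumEFin lee_fin big_mkord -big_mkcond.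
apply: lee_sum => k _; rewrite /F; case: ifPn => bk; last by rewrite integral_set0.
have I_gt0 x : I k x -> 0 < x by move=> Ix; apply: (F_gt0 k); rewrite /F bk.
have k1 : 0 < k.+1%:R * h by rewrite mulr_gt0.
apply: (@le_trans _ _ (\int[lebesgue_measure]_(x in I k) (cst ((k.+1%:R * h)^-1)%:E x))%E).
  apply: ge0_le_integral => //.
  - exact: mI.
  - by move=> x Ix; rewrite lee_fin invr_ge0 ltW//; exact: I_gt0 Ix.
  - exact: minv.
  - move=> x Ix; have x0 := I_gt0 _ Ix; rewrite lee_fin lef_pV2 ?posrE//.
    by move: Ix; rewrite /I/= in_itv/= => /andP[].
rewrite integral_cst; last exact: mI.
have muI : lebesgue_measure (I k) = h%:E.
  rewrite /I lebesgue_measure_itv/= lte_fin ltr_pM2r// ltr_nat ltnS leqnn.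
  by rewrite -EFinD -mulrBl -natrB// subSnn mul1r.
rewrite [X in (_ * X)%E]muI -EFinM lee_fin invfM -mulrA mulVf ?mulr1//.
by rewrite gt_eqF.
Qed.

Lemma small_differences (U : R -> R) h tau B sigma :
  0 < h -> 0 < tau -> 0 < sigma -> sigma + tau < 1 -> 0 < B ->
  (forall r1 r2, 0 <= r1 <= r2 -> U r1 <= U r2) ->
  (\forall r \near +oo, expR 1 <= U r) ->
  (\forall r \near +oo, ln (U r) <= B * r `^ tau) ->
  exists E : set R, finite_log_measure E /\
    forall eps, 0 < eps -> \forall r \near +oo, ~ E r ->
      U (r + h) - U (r - h) <= eps * (U r / r `^ sigma).
Proof.
move=> h0 tau0 sigma0 st B0 Umono [r1 [_ Uge]] [r2 [_ Ule]].
(* As [tau < 1], this gives [a <= tau + q = (1 - sigma + tau) / 2 < 1 - sigma]. *)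
pose q := (1 - sigma - tau) / 2; pose a := tau * (1 + q).
have q01 : 0 < q <= 1 by rewrite /q; lra.
have /andP[q0 q1] := q01.
have tauq : tau * q <= q by apply: ler_piMl; lra.
have tauq0 : 0 < tau * q by exact: mulr_gt0.
have a01 : 0 <= a <= 1.
  by rewrite /a mulrDr mulr1; move: tauq tauq0; rewrite /q; lra.
have sa : sigma < 1 - a by rewrite /a mulrDr mulr1; move: tauq; rewrite /q; lra.
pose r0 := Num.max (Num.max r1 r2) 0 + 1.
pose k0 := (Num.truncn (r0 / h)).+1.
have k0r (k : nat) : (k0 <= k)%N -> r0 < k%:R * h.
  move=> k0k; rewrite -ltr_pdivrMr//.
  have := truncnS_gt (r0 / h); move=> /lt_le_trans; apply.
  by rewrite ler_nat.
have Uk (k : nat) : (k0 <= k)%N -> 1 <= ln (U (k%:R * h)) /\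
    ln (U (k%:R * h)) <= B * (k%:R * h) `^ tau /\ 0 < U (k%:R * h).
  move=> /k0r; rewrite /r0 => kr.
  have m1 : r1 <= Num.max (Num.max r1 r2) 0 by rewrite !le_max lexx.
  have m2 : r2 <= Num.max (Num.max r1 r2) 0 by rewrite !le_max lexx orbT.
  have Ue : expR 1 <= U (k%:R * h) by apply: Uge; lra.
  have U0 : 0 < U (k%:R * h) by apply: lt_le_trans Ue; exact: expR_gt0.
  split; last by split=> //; apply: Ule; lra.
  by rewrite -[leLHS]expRK ler_ln ?posrE ?expR_gt0.
pose x (k : nat) : R := (k.+1%:R `^ (1 - a))^-1.
pose bad k := (k0 <= k)%N && ((1 + x k) * U (k%:R * h) < U (k.+3%:R * h)).
(* [maxn k k0] keeps [H] monotone and in [[-1, 0]] at all indices. *)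
pose H (k : nat) : R := - ((ln (U ((maxn k k0)%:R * h))) `^ q)^-1.
pose C := 4 * (B `^ (1 + q) * h `^ a) / q.
have C0 : 0 <= C.
  by apply: divr_ge0; [rewrite !mulr_ge0 ?powR_ge0 | exact: ltW].
have Umono_nat (k l : nat) : (k <= l)%N -> U (k%:R * h) <= U (l%:R * h).
  by move=> kl; apply: Umono; rewrite mulr_ge0 ?(ltW h0)//= ler_wpM2r ?ler_nat// (ltW h0).
have Hmono (k l : nat) : (k <= l)%N -> H k <= H l.
  move=> kl; have kl' : (maxn k k0 <= maxn l k0)%N.
    by rewrite geq_max leq_max kl leq_maxr.
  have [u1 [_ u2]] := Uk (maxn k k0) (leq_maxr _ _).
  have [v1 [_ v2]] := Uk (maxn l k0) (leq_maxr _ _).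
  have uv : ln (U ((maxn k k0)%:R * h)) <= ln (U ((maxn l k0)%:R * h)).
    by rewrite ler_ln ?posrE// Umono_nat.
  rewrite /H lerN2; move: uv u1 v1; move: (ln _) (ln _) => b b' b'b b1 b'1.
  have [b0 b'0] : 0 < b /\ 0 < b' by split; lra.
  rewrite lef_pV2 ?posrE ?powR_gt0//.
  by apply: ge0_ler_powR => //; rewrite ?nnegrE ltW.
have H01 k : -1 <= H k <= 0.
  have [u1 _] := Uk (maxn k k0) (leq_maxr _ _).
  rewrite /H lerN2 oppr_le0 invr_ge0 powR_ge0 andbT invf_le1.
    by rewrite -[leLHS](powRr0 (ln (U ((maxn k k0)%:R * h)))) ler_powR// ltW.
  by rewrite powR_gt0// (lt_le_trans ltr01).
have bad_le k : bad k -> k.+1%:R^-1 <= C * (H k.+3 - H k).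
  move=> /andP[k0k Ubad].
  have [u1 [uB u2]] := Uk k k0k.
  have [v1 [_ v2]] := Uk k.+3 (leq_trans k0k (leq_addl 3 k)).
  rewrite /H (maxn_idPl k0k) (maxn_idPl (leq_trans k0k (leq_addl 3 k))) opprK addrC.
  have x0 : 0 < x k by rewrite invr_gt0 powR_gt0.
  apply: (@log_jump_le _ q a B h tau) => //; first by rewrite ler1n.
    apply: (le_trans uB); rewrite ler_wpM2l ?(ltW B0)//.
    apply: ge0_ler_powR; rewrite ?nnegrE ?mulr_ge0 ?(ltW h0) ?(ltW tau0)//.
    by rewrite ler_wpM2r ?ler_nat// (ltW h0).
  rewrite -/(x k) addrC -lnM ?posrE//; last by lra.
  by rewrite ler_ln ?posrE ?ltW// mulr_gt0//; lra.
have sum_le N : \sum_(k < N | bad k) k.+1%:R^-1 <= C * 3.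
  (* Sums of three consecutive terms make the differences from [k] to [k+3] telescope; [H] lies in
     [[-1, 0]], so the total is at most 3. *)
  clearbody H; pose G k := H k + H k.+1 + H k.+2.
  apply: (@le_trans _ _ (\sum_(k < N) C * (G k.+1 - G k))).
    rewrite big_mkcond; apply: ler_sum => k _.
    have -> : G k.+1 - G k = H k.+3 - H k by rewrite /G; ring.
    case: ifP => [/bad_le//|_]; rewrite mulr_ge0// subr_ge0 Hmono//.
    exact: leq_addl 3 k.
  rewrite -mulr_sumr ler_wpM2l// -(big_mkord xpredT (fun k => G k.+1 - G k)).
  rewrite telescope_sumr// /G.
  have := H01 0%N; have := H01 1%N; have := H01 2%N.
  have := H01 N; have := H01 N.+1; have := H01 N.+2; lra.
exists (\bigcup_(k in [set k | bad k]) [set` `[k.+1%:R * h, k.+2%:R * h[]).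
split; first exact: finite_log_measure_bigcup sum_le.
move=> eps eps0.
(* Once [r ^ (1 - a - sigma) >= D], one has [(r / (2 * h)) ^ (a - 1) <= eps / r ^ sigma]. *)
pose D := (eps * (2 * h)^-1 `^ (1 - a))^-1.
have D0 : 0 < D by rewrite invr_gt0 mulr_gt0// powR_gt0// invr_gt0; lra.
near=> r => nEr.
have r_ge : k0.+2%:R * h <= r by near: r; apply: nbhs_pinfty_ge; rewrite num_real.
have rD : D `^ (1 - a - sigma)^-1 <= r by near: r; apply: nbhs_pinfty_ge; rewrite num_real.
have rpos : 0 < r by apply: lt_le_trans r_ge; rewrite mulr_gt0.
have [/andP[tr rt]] : (Num.truncn (r / h))%:R <= r / h < (Num.truncn (r / h)).+1%:R.
  by apply: truncn_itv; rewrite divr_ge0 ?ltW.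
have k0t : (k0.+1 < Num.truncn (r / h))%N.
  by rewrite truncn_ge_nat ?ler_pdivlMr ?divr_ge0 ?(ltW rpos) ?(ltW h0).
move: tr rt; rewrite ler_pdivlMr// ltr_pdivrMr//.
case: (Num.truncn _) k0t => // k; rewrite ltnS => /ltnW k0k kr rk.
(* Since [r] lies between [(k+1) * h] and [(k+2) * h], the interval from [r - h] to [r + h] lies
   between [k * h] and [(k+3) * h]: hence the gap of 3 in [bad]. *)
have nbad : ~~ bad k.
  apply/negP => bk; apply: nEr; exists k => //=.
  by rewrite in_itv/= kr rk.
have {nbad} Ule3 : U (k.+3%:R * h) <= (1 + x k) * U (k%:R * h).
  by move: nbad; rewrite /bad k0k /= -leNgt.
have [u1 [_ u0]] := Uk k k0k.
have kh0 : 0 <= k%:R * h by rewrite mulr_ge0 ?(ltW h0).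
have kS (m : nat) : m.+1%:R * h = m%:R * h + h by rewrite -addn1 natrD mulrDl mul1r.
have U1 : U (r + h) <= U (k.+3%:R * h) by apply: Umono; rewrite (kS k.+2); lra.
have U2 : U (k%:R * h) <= U (r - h) by apply: Umono; move: kr; rewrite (kS k); lra.
have U3 : U (k%:R * h) <= U r by apply: Umono; move: kr; rewrite (kS k); lra.
have x0 : 0 < x k by rewrite invr_gt0 powR_gt0.
apply: (@le_trans _ _ (x k * U r)).
  have := ler_wpM2l (ltW x0) U3; lra.
rewrite mulrCA mulrC ler_wpM2l//; first by lra.
rewrite /x -[leLHS]mul1r ler_pdivrMr ?powR_gt0// -ler_pdivrMl; last first.
  by rewrite divr_gt0// powR_gt0.
rewrite mulr1 invf_div ler_pdivrMr//.
(* From [r < (k+2) * h] and [k+2 <= 2 * (k+1)]. *)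
have kge : r * (2 * h)^-1 <= k.+1%:R.
  rewrite ler_pdivrMr; last by lra.
  by move: rk; rewrite (kS k.+1); have := ler_wpM2r (ltW h0) (ler1n R k.+1); lra.
have ka : (r * (2 * h)^-1) `^ (1 - a) <= k.+1%:R `^ (1 - a).
  apply: ge0_ler_powR; rewrite ?nnegrE ?mulr_ge0 ?invr_ge0//; lra.
rewrite mulrC; apply: le_trans (ler_wpM2l (ltW eps0) ka).
have h2 : 0 <= (2 * h)^-1 by rewrite invr_ge0; lra.
rewrite (powRM _ (ltW rpos) h2).
have -> : r `^ (1 - a) = r `^ (1 - a - sigma) * r `^ sigma.
  by rewrite -powRD ?subrK//; apply/implyP => _; rewrite gt_eqF.
have Dr : D <= r `^ (1 - a - sigma).
  have -> : D = (D `^ (1 - a - sigma)^-1) `^ (1 - a - sigma).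
    by rewrite -powRrM mulVf ?powRr1 ?ltW// gt_eqF//; lra.
  by apply: ge0_ler_powR; rewrite ?nnegrE ?powR_ge0 ?(ltW rpos)//; lra.
have Dinv : 1 = D * (eps * (2 * h)^-1 `^ (1 - a)).
  rewrite /D mulVf// gt_eqF// mulr_gt0// powR_gt0// invr_gt0; lra.
rewrite [leRHS](_ : _ = (r `^ (1 - a - sigma) * (eps * (2 * h)^-1 `^ (1 - a))) * r `^ sigma); last by ring.
rewrite -[leLHS]mul1r ler_wpM2r ?powR_ge0// {1}Dinv ler_wpM2r//.
by rewrite mulr_ge0 ?powR_ge0// ltW.
Unshelve. all: by end_near. Qed.
End LogMeasure.

(** * The majorant of increments and the final estimate *)

Section Majorant.
Context {R : realType}.
Implicit Types (f : R -> R) (r : R) (U : R -> R).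

Lemma knot_variation_ge0 n t (p : nat -> {poly R}) N r :
  0 <= knot_variation n t p N r.
Proof.
apply: sumr_ge0 => m _; apply: sumr_ge0 => j _.
by rewrite mulr_ge0// exprn_ge0// le_max lexx orbT.
Qed.

Lemma majorant_exists n f delta : well_defined_meromorphic n f ->
  delta = 1 \/ delta = -1 ->
  exists U, [/\ forall r, 0 <= r -> 0 <= U r,
    forall r1 r2, 0 <= r2 <= r1 ->
      `|f (delta * r1) - f (delta * r2)| <= U r1 - U r2,
    forall lambda r, 1 <= lambda -> 0 <= r -> lambda * U r <= U (lambda * r) &
    forall r, 0 < r -> 0 <= characteristic n r f /\
      U r <= 12 * characteristic n r f + 7 * `|f 0|].
Proof.
move=> wf d.
have [t1 [p1 k1]] := well_defined_knots _ _ 1 wf (or_introl erefl).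
have [t2 [p2 k2]] := well_defined_knots _ _ (-1) wf (or_intror erefl).
have unb r : exists N, [/\ (0 < N)%N, r <= t1 N & r <= t2 N].
  have [N1 rN1] := knots_unbounded _ _ _ _ k1 r.
  have [N2 rN2] := knots_unbounded _ _ _ _ k2 r.
  exists (maxn N1 N2).+1; split => //.
    by rewrite (le_trans (ltW rN1))// (knots_le _ _ _ _ k1)// leqW// leq_maxl.
  by rewrite (le_trans (ltW rN2))// (knots_le _ _ _ _ k2)// leqW// leq_maxr.
(* The majorant is built on one half-line, but its bound needs the knots of both. *)
have [t [p [kp bound]]] : exists t (p : nat -> {poly R}),
    knots n (fun x => f (delta * x)) t p /\
    forall r, 0 < r -> 0 <= characteristic n r f /\ exists2 N, r <= t N &
      knot_variation n t p N r <= 12 * characteristic n r f + 7 * `|f 0|.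
  case: d => ->; [exists t1, p1 | exists t2, p2]; split=> // r r0;
    have [N [N0 rN1 rN2]] := unb r;
    have [T0 T1 T2] := variation_le_characteristic _ _ _ _ _ _ _ _ k1 k2 N0 r0 rN1 rN2;
    by split => //; exists N.
have [U UE] := variation_exists _ _ _ _ kp.
have unbt r : exists N, r <= t N.
  by have [N /ltW] := knots_unbounded _ _ _ _ kp r; exists N.
exists U; split.
- move=> r r0; have [N rN] := unbt r.
  by rewrite (UE N) ?r0// knot_variation_ge0.
- move=> r1 r2 /andP[r20 r21]; have [N rN] := unbt r1.
  have r10 : 0 <= r1 <= t N by rewrite rN andbT (le_trans r20).
  have r20N : 0 <= r2 <= t N by rewrite r20 (le_trans r21).
  rewrite (UE N)// (UE N)//.
  rewrite (knots_eq_sum _ _ _ _ kp _ _ r10) (knots_eq_sum _ _ _ _ kp _ _ r20N).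
  rewrite opprD addrACA subrr add0r.
  exact: knot_variation_ge.
- move=> lambda r l1 r0; have [N rN] := unbt (lambda * r).
  have rlr : r <= lambda * r by exact: ler_peMl.
  have rN1 : 0 <= r <= t N by rewrite r0 (le_trans rlr).
  have rN2 : 0 <= lambda * r <= t N by rewrite rN andbT (le_trans r0).
  rewrite (UE _ _ rN1) (UE _ _ rN2).
  exact: (knot_variation_scale _ _ _ _ _ _ _ kp l1).
- move=> r r0; have [T0 [N rN VT]] := bound r r0.
  by split=> //; rewrite (UE N)// ltW.
Qed.

Lemma limf_esup_lt (F : set_system R) (g : R -> \bar R) (a : \bar R) :
  Filter F -> (limf_esup g F < a)%E -> \forall x \near F, (g x < a)%E.
Proof.
move=> FF /ereal_inf_lt[_ [V FV <-] supa].
apply: filterS FV => x Vx; apply: le_lt_trans supa.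
by apply: ereal_sup_ubound; exists x.
Qed.

Lemma finite_log_measure0 : finite_log_measure (set0 : set R).
Proof. by split=> //; rewrite set0I integral_set0. Qed.

(** In the outward coordinate the shift is [delta * c], of modulus [|c|]; whichever its sign, the
    increment of [f] is taken within the interval from [r - |c|] to [r + |c|]. *)
Lemma majorant_step f U delta c r : delta = 1 \/ delta = -1 ->
  (forall r1 r2, 0 <= r2 <= r1 ->
    `|f (delta * r1) - f (delta * r2)| <= U r1 - U r2) ->
  `|c| <= r -> `|f (delta * r + c) - f (delta * r)| <= U (r + `|c|) - U (r - `|c|).
Proof.
move=> d dU cr; have c0 := normr_ge0 c.
have Umono r1 r2 : 0 <= r2 <= r1 -> U r2 <= U r1.
  by move=> /dU/(le_trans (normr_ge0 _)); rewrite subr_ge0.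
have dd : delta * delta = 1 by case: d => ->; ring.
have -> : delta * r + c = delta * (r + delta * c) by rewrite mulrDr mulrA dd mul1r.
have : `|delta * c| = `|c| by rewrite normrM; case: d => ->; rewrite ?normrN normr1 mul1r.
move: (delta * c) => e ec; have [e0|e0] := ger0P e.
  rewrite -ec (ger0_norm e0); apply: le_trans (dU _ _ _) _; first by lra.
  by rewrite lerD2l lerN2 Umono//; move: cr; rewrite -ec (ger0_norm e0); lra.
move: cr; rewrite -ec (ltr0_norm e0) opprK distrC => cr.
apply: le_trans (dU _ _ _) _; first by lra.
by rewrite lerD2r Umono//; lra.
Qed.
End Majorant.

Theorem theorem4p7 (R : realType) (n : nat) (c : R) (f : R -> R) (sigma : R)
    (hn : (0 < n)%N) (hc : c != 0)
    (hf : well_defined_meromorphic n f)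
    (hrho : (hyper_order n f < 1)%E)
    (hsigma0 : 0 < sigma) (hsigma1 : (sigma%:E < 1 - hyper_order n f)%E) :
  forall delta : R, delta = 1 \/ delta = -1 ->
  exists E : set R, finite_log_measure E /\
    forall eps : R, 0 < eps -> \forall r \near +oo, ~ E r ->
      `|f (delta * r + c) - f (delta * r)| <=
        eps * (characteristic n r f / r `^ sigma).
Proof.
move=> delta d.
have [U [U_ge0 dU scaleU UT]] := majorant_exists _ _ _ hf d.
have step r := majorant_step _ _ _ c r d dU.
have Umono r1 r2 : 0 <= r1 <= r2 -> U r1 <= U r2.
  by move=> /dU/(le_trans (normr_ge0 _)); rewrite subr_ge0.
(* If [U] vanishes identically, [f] is constant on the half-line and the empty exceptional set will
   do. *)
have [[a [a0 Ua]]|U0] := pselect (exists a, 0 <= a /\ 0 < U a); last first.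
  have {}U0 r : 0 <= r -> U r = 0.
    move=> r0; apply/eqP; rewrite eq_le U_ge0// andbT leNgt; apply/negP => Ur.
    by apply: U0; exists r.
  exists set0; split; first exact: finite_log_measure0.
  move=> eps eps0; near=> r => _.
  have cr : `|c| <= r by near: r; apply: nbhs_pinfty_ge; rewrite num_real.
  have r0 : 0 < r by near: r; apply: nbhs_pinfty_gt; rewrite num_real.
  apply: le_trans (step _ cr) _.
  have c0 := normr_ge0 c.
  rewrite !U0 ?subr_ge0 ?addr_ge0 ?(ltW r0)// subrr.
  by rewrite mulr_ge0 ?(ltW eps0)// divr_ge0 ?powR_ge0//; have [] := UT r r0.
have {a0}a0 : 0 < a.
  rewrite lt_neqAle a0 andbT; apply/negP => /eqP a0'.
  have := scaleU 2 0 _ (lexx _); rewrite mulr0 a0' ler1n => /(_ isT).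
  by lra.
(* By [scaleU], [U r >= (r / a) * U a]. *)
have Ubig M : \forall r \near +oo, M <= U r.
  near=> r.
  have ra : a <= r by near: r; apply: nbhs_pinfty_ge; rewrite num_real.
  have rM : M * a / U a <= r by near: r; apply: nbhs_pinfty_ge; rewrite num_real.
  have l1 : 1 <= r / a by rewrite ler_pdivlMr// mul1r.
  have := scaleU _ _ l1 (ltW a0); rewrite divfK ?gt_eqF//; apply: le_trans.
  by rewrite mulrAC ler_pdivlMr// -ler_pdivrMr.
(* Once [7 * |f 0| <= U r / 2], this term is absorbed and 12 doubles to 24. *)
have TU : \forall r \near +oo, U r <= 24 * characteristic n r f.
  near=> r.
  have r0 : 0 < r by near: r; apply: nbhs_pinfty_gt; rewrite num_real.
  have : 14 * `|f 0| <= U r by near: r; exact: Ubig.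
  by have [_] := UT r r0; lra.
have Te : \forall r \near +oo, expR 1 <= characteristic n r f.
  near=> r.
  have : 24 * expR 1 <= U r by near: r; exact: Ubig.
  have : U r <= 24 * characteristic n r f by near: r.
  by lra.
have ln_pos : \forall r \near +oo, 0 < ln r :> R.
  near=> r; apply: ln_gt0.
  by near: r; apply: nbhs_pinfty_gt; rewrite num_real.
have lnT r : expR 1 <= characteristic n r f -> 1 <= ln (characteristic n r f).
  move=> eT; rewrite -[leLHS]expRK ler_ln ?posrE ?expR_gt0//.
  by apply: lt_le_trans eT; exact: expR_gt0.
(* Eventually [ln T >= 1], so the quotients are non-negative. This excludes the value [-oo] and
   leaves a finite hyper-order. *)
have rho_ge0 : (0 <= hyper_order n f)%E.
  rewrite leNgt; apply/negP => /limf_esup_lt rho_lt0.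
  have [] := @filter_ex _ (pinfty_nbhs R) _ _ (filterI rho_lt0 (filterI ln_pos Te)).
  move=> r [+ [lr eT]]; rewrite lte_fin; apply/negP; rewrite -leNgt.
  by rewrite divr_ge0 ?(ltW lr)// ln_ge0// lnT.
have [rho rhoE] : exists rho, hyper_order n f = rho%:E.
  exists (fine (hyper_order n f)); rewrite fineK// fin_numE.
  by case: (hyper_order n f) rho_ge0 hrho => [x||].
rewrite rhoE lee_fin in rho_ge0.
have sr : sigma < 1 - rho by move: hsigma1; rewrite rhoE -EFinD lte_fin.
(* The midpoint of [rho] and [1 - sigma] satisfies both [rho < tau] and [sigma + tau < 1]. *)
pose tau := (rho + (1 - sigma)) / 2.
have T_le : \forall r \near +oo, ln (characteristic n r f) <= r `^ tau.
  have : (hyper_order n f < tau%:E)%E by rewrite rhoE lte_fin /tau; lra.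
  move=> /limf_esup_lt rho_lt; near=> r.
  have : ln (ln (characteristic n r f)) / ln r < tau.
    by rewrite -lte_fin; near: r; exact: rho_lt.
  have lr : 0 < ln r by near: r.
  have r0 : 0 < r by near: r; apply: nbhs_pinfty_gt; rewrite num_real.
  have eT : expR 1 <= characteristic n r f by near: r.
  rewrite ltr_pdivrMr// -ln_powR ltr_ln ?posrE ?powR_gt0//; first exact: ltW.
  by rewrite (lt_le_trans ltr01)// lnT.
(* The constant 25 leaves room for [ln U <= ln 24 + ln T <= 23 + r ^ tau <= 24 * r ^ tau]. *)
have [| | | | |E [finE Esmall]] :=
    @small_differences R U `|c| tau 25 sigma _ _ hsigma0 _ _ Umono (Ubig _).
- by rewrite normr_gt0.
- by rewrite /tau; lra.
- by rewrite /tau; lra.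
- by [].
- near=> r.
  have r1 : 1 <= r by near: r; apply: nbhs_pinfty_ge; rewrite num_real.
  have Ue : expR 1 <= U r by near: r; exact: Ubig.
  have eT : expR 1 <= characteristic n r f by near: r.
  have UT24 : U r <= 24 * characteristic n r f by near: r.
  have T0 : 0 < characteristic n r f by apply: lt_le_trans eT; exact: expR_gt0.
  have U0 : 0 < U r by apply: lt_le_trans Ue; exact: expR_gt0.
  have lnTr : ln (characteristic n r f) <= r `^ tau by near: r.
  have lnU : ln (U r) <= ln 24 + ln (characteristic n r f).
    by rewrite -lnM ?posrE// ler_ln ?posrE// mulr_gt0.
  have ln24 : ln 24 <= 23 :> R.
    by have := @le_ln1Dx R 23; rewrite (_ : 1 + 23 = 24); [apply | ]; lra.
  have rt1 : 1 <= r `^ tau.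
    by rewrite -[leLHS](powRr0 r) ler_powR// /tau; lra.
  by lra.
exists E; split => // eps eps0; near=> r => nEr.
have cr : `|c| <= r by near: r; apply: nbhs_pinfty_ge; rewrite num_real.
have r0 : 0 < r by near: r; apply: nbhs_pinfty_gt; rewrite num_real.
apply: le_trans (step _ cr) _.
apply: (@le_trans _ _ (eps / 24 * (U r / r `^ sigma))).
  move: nEr; near: r; apply: Esmall; lra.
rewrite -mulrA ler_wpM2l ?(ltW eps0)// mulrA ler_wpM2r ?invr_ge0 ?powR_ge0//.
have : U r <= 24 * characteristic n r f by near: r.
by lra.
Unshelve. all: by end_near. Qed.
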